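(* Let $k\ge 1$ be an integer and let $z_1,\dots,z_k,q$ be complex numbers with $|q|<1$. Let $F$ be the $1\times\infty$ board with weight function $F_w(kn+j)=z_jq^{n+1}$ for $j=1,\dots,k$ and $n=0,1,2,\dots$, and for each integer $m\ge 0$ let $F(m)$ be the generating function of all tilings of $F$ with exactly $m$ black tiles. Set $F(m)=0$ for $m<0$. Then $$\prod_{m=1}^{\infty}(1+z_1q^m)(1+z_2q^m)\cdots(1+z_kq^m)=\sum_{m=0}^{\infty}F(m),$$ and the $F(m)$ are given recursively by $F(0)=1$, $F(1)=\frac{q}{1-q}\sum_{i=1}^{k}z_i=\frac{q}{1-q}S_1^k(z_1,\dots,z_k)$, and, for all $m\ge 1$, $$F(m)=\frac{q^m}{1-q^m}\sum_{n=1}^{k}S_n^k(z_1,z_2,\dots,z_k)\,F(m-n).$$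
   Context: $S_n^k(z_1,\dots,z_k):=\sum_{1\le i_1<i_2<\cdots<i_n\le k}z_{i_1}z_{i_2}\cdots z_{i_n}$ is the elementary symmetric polynomial of degree $n$ in $z_1,\dots,z_k$. A $1\times\infty$ board has positions $1,2,3,\dots$; its weight function $F_w$ assigns a fixed weight $F_w(i)$ to each position $i$. A tiling $T$ assigns to each position the colour black or white, with only finitely many positions black. The weight of $T$ is $W(T)=\prod_{i:\,T(i)=\text{black}}F_w(i)$ (white tiles contribute $1$). The generating function of tilings with exactly $m$ black tiles is $F(m)=\sum_T W(T)$, the sum over all tilings $T$ with exactly $m$ black tiles; equivalently $F(m)=\sum_{1\le i_1<\cdots<i_m}F_w(i_1)\cdots F_w(i_m)$. *)

(* Defs.v *)
From HB Require Import structures.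
From mathcomp Require Import all_boot all_order all_algebra.
From mathcomp Require Import all_classical all_reals all_analysis.
From mathcomp Require Import complex.
(* Not imported: the notations of mpoly clash with those of MathComp-Analysis. *)
From mathcomp Require mpoly.

Set Implicit Arguments.
Unset Strict Implicit.
Unset Printing Implicit Defensive.

Import Order.TTheory GRing.Theory Num.Theory numFieldNormedType.Exports.

Local Open Scope classical_set_scope.
Local Open Scope ring_scope.

(* S_n^k(z_1, ..., z_k); the variable z_j is [z] at the ordinal j - 1. *)
Definition elem_sym (K : numFieldType) (k n : nat) (z : 'I_k -> K) : K :=
  mpoly.meval z (mpoly.mesym k K n).

(* The directed system of the finite subsets of A, ordered by inclusion. *)
Definition finite_subsets (I : choiceType) (A : set I) : set_system (set I) :=
  filter_from (fsets A) (fun X => [set Y | fsets A Y /\ X `<=` Y]).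

(* Unordered (unconditional) summation: the families summed below are indexed
   by infinite sets of tilings that carry no preferred enumeration. *)
Definition usummable (K : numFieldType) (I : choiceType) (A : set I)
    (f : I -> K) : Prop :=
  cvg ((fun X : set I => \sum_(i \in X) f i) @ finite_subsets A).

Definition usum (K : numFieldType) (I : choiceType) (A : set I)
    (f : I -> K) : K :=
  lim ((fun X : set I => \sum_(i \in X) f i) @ finite_subsets A).

Definition position : Type := {i : nat | (0 < i)%N}.

(* A colouring of the positions: [true] is black, [false] is white. *)
Definition coloring : Type := position -> bool.

Definition black (T : coloring) : set position := [set i | T i].

(* The junk value 1 of [\big] on an infinite support is never met: only
   colourings with finitely many black positions are tilings. *)
Definition tiling_weight (K : numFieldType) (Fw : position -> K)
    (T : coloring) : K :=
  \big[*%R/1]_(i \in black T) Fw i.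

Definition tilings (m : nat) : set coloring := [set T | (black T #= `I_m)%card].

(* F(m) for the board with weight function Fw, extended by 0 to m < 0. *)
Definition board_gf (K : numFieldType) (Fw : position -> K) (m : int) : K :=
  if m is Posz n then usum (tilings n) (tiling_weight Fw) else 0.

(* Main.v *)
Require Import Defs.
From HB Require Import structures.
From mathcomp Require Import all_boot all_order all_algebra.
From mathcomp Require Import all_classical all_reals all_analysis.
From mathcomp Require Import complex finmap.

Set Implicit Arguments.
Unset Strict Implicit.
Unset Printing Implicit Defensive.

Import Order.TTheory GRing.Theory Num.Theory numFieldNormedType.Exports.

Local Open Scope classical_set_scope.
Local Open Scope ring_scope.
Local Open Scope complex_scope.

(** Index the weights by w_i, the weight of position i + 1.  The polynomial
    B_N(t) = prod_(i < N) (1 + w_i t) has as its coefficient of t^m the total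
    weight of the tilings with m black tiles, all among the first N positions:
    expanding the product amounts to choosing the black positions.  Everything
    follows from letting N tend to infinity.

    The analysis rests on one domination principle.  Let B'_N be the same
    polynomial for the weights |w_i|.  If Y is a finite set of tilings lying
    between those bounded by N and those bounded by M, the triangle inequality
    gives (dist_sum_tilings)
      |sum_Y W - [t^m] B_N| <= [t^m] B'_M - [t^m] B'_N,
    and the right-hand side is a difference of terms of a nondecreasing
    sequence, bounded by prod_i (1 + |w_i|).  Such a bound forces convergence
    (dominated_cvgn), because in R[i] the real and imaginary parts of the
    dominated sequence become monotone after adding the dominating one.  Hence
    the unordered sum F(m) exists and is the limit of [t^m] B_N
    (board_gf_cvg).  Summing the same estimate over m compares partial sums of
    the F(m) with B_N(1), which gives sum_m F(m) = prod_i (1 + w_i)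
    (sum_board_gf_cvg).

    The specific board enters through w_(k + i) = q w_i.  This bounds the sums
    of the |w_i|, hence prod_i (1 + |w_i|), and gives the functional equation
    B_(k + N)(t) = A(q t) B_N(q t) with A(t) = prod_j (1 + z_j t), whose
    coefficients are the S_r^k.  Comparing coefficients of t^m and letting N
    tend to infinity,
      F(m) = q^m sum_(r <= m) S_r F(m - r),
    and solving for the term r = 0, which is q^m F(m), gives the recursion. *)

(** * Coefficients of products of linear factors *)

(** Choosing the term with t in the factors indexed by A contributes the
    product over A in degree #|A|. *)
Lemma coef_prod_linear (K : comNzRingType) (N : nat) (w : 'I_N -> K) (m : nat) :
  (\prod_(i < N) (1 + (w i)%:P * 'X))`_m =
  \sum_(A : {set 'I_N} | #|A| == m) \prod_(i in A) w i.
Proof.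
under eq_bigr do rewrite addrC.
rewrite bigA_distr coef_sum [RHS]big_mkcond; apply: eq_bigr => A _ /=.
rewrite -big_mkcond /= big_split /= prodr_const -rmorph_prod /=.
by rewrite coefCM coefXn eq_sym; case: eqP; rewrite ?mulr1 ?mulr0.
Qed.

Lemma coef0_prod_linear (K : comNzRingType) (N : nat) (w : 'I_N -> K) :
  (\prod_(i < N) (1 + (w i)%:P * 'X))`_0 = 1.
Proof.
rewrite coef_prod_linear (big_pred1 finset.set0) ?big_set0// => A.
by rewrite cards_eq0.
Qed.

Lemma coef_prod_elem_sym (K : numFieldType) (k : nat) (z : 'I_k -> K)
    (r : nat) :
  (\prod_(j < k) (1 + (z j)%:P * 'X))`_r = elem_sym r z.
Proof.
rewrite coef_prod_linear /elem_sym /mpoly.mesym.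
rewrite (big_morph _ (mpoly.mevalD z) (mpoly.meval0 z)).
apply: eq_bigr => A _; rewrite (big_morph _ (mpoly.mevalM z) (mpoly.meval1 z)).
by apply: eq_bigr => i _; rewrite mpoly.mevalXU.
Qed.

Lemma elem_sym0 (K : numFieldType) k (z : 'I_k -> K) : elem_sym 0 z = 1.
Proof. by rewrite -coef_prod_elem_sym coef0_prod_linear. Qed.

Lemma elem_sym1 (K : numFieldType) k (z : 'I_k -> K) :
  elem_sym 1 z = \sum_(i < k) z i.
Proof.
rewrite -coef_prod_elem_sym.
elim: k z => [|k IHk] z; first by rewrite !big_ord0 coef1.
rewrite !big_ord_recl /= mulrDl mul1r coefD IHk -mulrA coefCM coefXM /=.
by rewrite coef_prod_elem_sym elem_sym0 mulr1 addrC.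
Qed.

Lemma elem_sym_gt (K : numFieldType) k (z : 'I_k -> K) r :
  (k < r)%N -> elem_sym r z = 0.
Proof.
move=> kr; rewrite -coef_prod_elem_sym coef_prod_linear big_pred0// => A.
apply/negbTE; rewrite neq_ltn (leq_ltn_trans _ kr)//.
by rewrite -[X in (_ <= X)%N]card_ord max_card.
Qed.

(** The generating polynomial, in the number of black tiles, of the tilings of
    the first N positions, where w i is the weight of position i + 1. *)
Definition board_poly (K : comNzRingType) (w : nat -> K) (N : nat) : {poly K} :=
  \prod_(i < N) (1 + (w i)%:P * 'X).

Lemma size_board_poly (K : comNzRingType) (w : nat -> K) N :
  (size (board_poly w N) <= N.+1)%N.
Proof.
elim: N => [|N IHN]; first by rewrite /board_poly big_ord0 size_poly1.
rewrite /board_poly big_ord_recr /=; apply: leq_trans (size_polyMleq _ _) _.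
have: (size (1 + (w N)%:P * 'X : {poly K})%R <= 2)%N.
  rewrite (leq_trans (size_polyD _ _)) // geq_max size_poly1 /=.
  rewrite (leq_trans (size_polyMleq _ _)) // size_polyX addn2 /=.
  by rewrite ltnS size_polyC leq_b1.
move=> s2; have := leq_add IHN s2; rewrite addn2 /board_poly => /=.
by case: (_ + _)%N.
Qed.

Lemma horner1_board_poly (K : comNzRingType) (w : nat -> K) N :
  (board_poly w N).[1] = \prod_(i < N) (1 + w i).
Proof.
rewrite /board_poly horner_prod; apply: eq_bigr => i _.
by rewrite !hornerE.
Qed.

Lemma horner1_sum_coef (K : nzRingType) (p : {poly K}) n : (size p <= n)%N ->
  p.[1] = \sum_(0 <= i < n) p`_i.
Proof.
move=> /horner_coef_wide ->; rewrite big_mkord.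
by apply: eq_bigr => i _; rewrite expr1n mulr1.
Qed.

Lemma coef_board_poly_scale (K : comNzRingType) (c : K) (w : nat -> K) N m :
  (board_poly (fun i => c * w i) N)`_m = c ^+ m * (board_poly w N)`_m.
Proof.
rewrite /board_poly !coef_prod_linear mulr_sumr; apply: eq_bigr => A /eqP <-.
by rewrite big_split /= prodr_const.
Qed.

Lemma board_polyD (K : comNzRingType) (w : nat -> K) M N :
  board_poly w (M + N) = board_poly w M * board_poly (fun i => w (M + i)%N) N.
Proof. by rewrite /board_poly big_split_ord. Qed.

(** * Tilings whose black tiles lie among the first N positions *)

(** Positions are counted from 1, the weights w i from 0. *)
Definition pos (i : nat) : position := exist _ i.+1 isT.

Lemma pos_inj : injective pos.
Proof. by move=> i j [->]. Qed.

Lemma pos_pred (p : position) : pos (val p).-1 = p.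
Proof. by apply: val_inj; case: p => -[]. Qed.

Definition bounded_tilings (N m : nat) : set coloring :=
  tilings m `&` [set T | forall p, T p -> (val p <= N)%N].

Definition paint N (A : {set 'I_N}) : coloring :=
  fun p => [exists i in A, pos i == p].

Lemma black_paint N (A : {set 'I_N}) :
  black (paint A) = (fun i : 'I_N => pos i) @` [set` A].
Proof.
apply/seteqP; split => p /=.
  by move=> /existsP[i /andP[iA /eqP]]; exists i.
by move=> [i iA <-]; apply/existsP; exists i; rewrite iA eqxx.
Qed.

Lemma paint_pos N (A : {set 'I_N}) (i : 'I_N) : paint A (pos i) = (i \in A).
Proof.
apply/existsP/idP => [[j /andP[jA /eqP/pos_inj/val_inj <-]]//|iA].
by exists i; rewrite iA eqxx.
Qed.

Lemma card_set_finset (I : finType) (A : {set I}) : ([set` A] #= `I_#|A|)%card.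
Proof.
have -> : [set` A] = enum_val @` [set: 'I_#|A|].
  apply/seteqP; split => x /=; last by move=> [i _ <-]; exact: enum_valP.
  by move=> xA; exists (enum_rank_in xA x); rewrite ?enum_rankK_in.
rewrite (card_eqr card_II); apply: inj_card_eq => i j _ _; exact: enum_val_inj.
Qed.

Lemma card_black_paint N (A : {set 'I_N}) : (black (paint A) #= `I_#|A|)%card.
Proof.
rewrite black_paint; apply: card_eq_trans (card_set_finset A).
by apply: inj_card_eq => i j _ _ /pos_inj/val_inj.
Qed.

Lemma paint_bij N m :
  set_bij [set A : {set 'I_N} | #|A| == m] (bounded_tilings N m) (@paint N).
Proof.
split.
- move=> A /= /eqP <-; split; first exact: card_black_paint.
  by move=> p /existsP[i /andP[_ /eqP <-]]; exact: ltn_ord.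
- move=> A B _ _ eqAB; apply/setP => i.
  by rewrite -!paint_pos eqAB.
- move=> T [Tm TN].
  pose A := finset (fun i : 'I_N => T (pos i)).
  have TE : T = paint A.
    apply/funext => p; apply/idP/existsP => [Tp|]; last first.
      by case=> i; rewrite inE => /andP[Ti /eqP <-].
    have pN : ((val p).-1 < N)%N by rewrite prednK ?TN//; case: (p).
    by exists (Ordinal pN); rewrite inE /= pos_pred Tp eqxx.
  exists A => //=; apply/eqP/card_eq_II.
  apply: card_eq_trans Tm; rewrite card_eq_sym {1}TE.
  exact: card_black_paint.
Qed.

Lemma tiling_weight_paint (K : numFieldType) (Fw : position -> K) N
    (A : {set 'I_N}) :
  tiling_weight Fw (paint A) = \prod_(i in A) Fw (pos i).
Proof.
rewrite /tiling_weight black_paint fsbig_image; last first.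
  by move=> i j _ _ /pos_inj/val_inj.
rewrite -big_enum [RHS]fsbig_seq ?enum_uniq//; apply: eq_fsbigl.
by apply/seteqP; split => i /=; rewrite mem_enum.
Qed.

(** Through paint, these tilings are the m-element subsets of 'I_N that the
    coefficient of t^m enumerates. *)
Lemma sum_bounded_tilings (K : numFieldType) (Fw : position -> K) N m :
  \sum_(T \in bounded_tilings N m) tiling_weight Fw T =
  (board_poly (fun i => Fw (pos i)) N)`_m.
Proof.
rewrite (reindex_fsbig _ _ _ _ (paint_bij N m)) /board_poly coef_prod_linear.
under eq_fsbigr do rewrite tiling_weight_paint.
rewrite -big_enum [RHS]fsbig_seq ?enum_uniq//; apply: eq_fsbigl.
by apply/seteqP; split => A /=; rewrite mem_enum.
Qed.

Lemma finite_bounded_tilings N m : finite_set (bounded_tilings N m).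
Proof.
have [funP _ surjP] := paint_bij N m; rewrite -(surj_image_eq _ surjP).
  exact/finite_image/finite_finset.
by move=> _ [A mA <-]; exact: funP.
Qed.

Lemma normr_tiling_weight (K : numFieldType) (Fw : position -> K) T :
  finite_set (black T) ->
  `|tiling_weight Fw T| = tiling_weight (fun p => `|Fw p|) T.
Proof. by move=> fT; rewrite /tiling_weight !fsbig_finite// normr_prod. Qed.

Lemma finite_black m T : tilings m T -> finite_set (black T).
Proof. by move=> Tm; exists m. Qed.

Lemma sub_bounded_tilings N M m : (N <= M)%N ->
  bounded_tilings N m `<=` bounded_tilings M m.
Proof.
by move=> NM T [Tm TN]; split => // p /TN /leq_trans; apply.
Qed.

(** A finite set of tilings has a last black position; this is what turns the
    limit along finite sets of tilings into a limit along N. *)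
Lemma bounded_tilings_cofinal m (X : set coloring) N :
  fsets (tilings m) X -> exists2 M, (N <= M)%N & X `<=` bounded_tilings M m.
Proof.
move=> [fX Xm].
pose last_black T := (\max_(p <- fset_set (black T)) val p)%N.
exists (maxn N (\max_(T <- fset_set X) last_black T)); first exact: leq_maxl.
move=> T XT; split; first exact: Xm.
move=> p Tp; have fT := finite_black (Xm _ XT).
apply: leq_trans (leq_maxr _ _).
apply: (@leq_trans (last_black T)).
  apply: (leq_bigmax_seq p) => //; rewrite in_fset_set//; exact: mem_set.
by apply: (leq_bigmax_seq T) => //; rewrite in_fset_set//; exact: mem_set.
Qed.

(** The tilings of Y that are not bounded by N contribute at most the sum of
    their absolute weights, and these all occur in the coefficient for M. *)
Lemma dist_sum_tilings (K : numFieldType) (Fw : position -> K) m N M Y :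
  bounded_tilings N m `<=` Y -> Y `<=` bounded_tilings M m ->
  `|\sum_(T \in Y) tiling_weight Fw T -
     (board_poly (fun i => Fw (pos i)) N)`_m| <=
  (board_poly (fun i => `|Fw (pos i)|) M)`_m -
  (board_poly (fun i => `|Fw (pos i)|) N)`_m.
Proof.
move=> NY YM.
have fM := finite_bounded_tilings M m.
have fY := sub_finite_set YM fM.
set W' := tiling_weight (fun p => `|Fw p|).
have W'E T : tilings m T -> W' T = `|tiling_weight Fw T|.
  by move=> /finite_black fT; rewrite normr_tiling_weight.
have diff A B (W : coloring -> K) : finite_set B -> A `<=` B ->
  \sum_(T \in B) W T - \sum_(T \in A) W T = \sum_(T \in B `\` A) W T.
  by move=> fB AB; rewrite (fsbigID A)//= setDE (setIidr AB) addrC addrK.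
rewrite -(sum_bounded_tilings Fw) -!(sum_bounded_tilings (fun p => `|Fw p|)).
rewrite diff//.
apply: (@le_trans _ _ (\sum_(T \in Y) W' T -
                       \sum_(T \in bounded_tilings N m) W' T)).
  rewrite diff// !fsbig_finite; try exact: finite_setD.
  apply: le_trans (ler_norm_sum _ _ _) _; rewrite le_eqVlt; apply/orP; left.
  apply/eqP/eq_big_seq => T; rewrite in_fset_set; last exact: finite_setD.
  by move=> /set_mem[/YM[mT _] _]; rewrite W'E.
rewrite lerB// -subr_ge0 diff//; apply: fsumr_ge0 => T [[mT _] _].
by rewrite -/W' W'E.
Qed.

(** * Unordered sums and dominated sequences of complex numbers *)

#[local] Instance finite_subsets_filter (I : choiceType) (A : set I) :
  ProperFilter (finite_subsets A).
Proof.
apply: filter_from_proper; last by move=> X AX; exists X; split.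
apply: filter_from_filter; first by exists set0; split.
move=> X Y [fX XA] [fY YA]; exists (X `|` Y).
  by split => [|x [/XA|/YA]//]; rewrite finite_setU.
by move=> Z [AZ]; rewrite subUset => -[XZ YZ].
Qed.

Section ComplexSequences.
Variable R : realType.
Local Notation C := (R[i])^o.

Lemma normc_real (x : R) : `|x%:C| = `|x|%:C.
Proof. by rewrite normc_def /= expr0n addr0 sqrtr_sqr. Qed.

Lemma normc_Re (x : R[i]) : `|(complex.Re x)%:C| <= `|x|.
Proof.
by rewrite normc_real normc_def lecR -sqrtr_sqr ler_wsqrtr// lerDl sqr_ge0.
Qed.

Lemma normc_Im (x : R[i]) : `|(complex.Im x)%:C| <= `|x|.
Proof.
by rewrite normc_real normc_def lecR -sqrtr_sqr ler_wsqrtr// lerDr sqr_ge0.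
Qed.

(** In the order of R[i], comparable numbers have equal imaginary parts, so
    only the real parts move. *)
Lemma nondecreasing_bounded_cvgn (v : nat -> C) (B : C) :
  {homo v : n m / (n <= m)%N >-> n <= m} -> (forall n, v n <= B) -> cvgn v.
Proof.
move=> v_ndecr vB.
have a_cvg : cvgn (fun n => complex.Re (v n)).
  apply: nondecreasing_is_cvgn.
    by move=> n m /v_ndecr; rewrite lecE => /andP[].
  by exists (complex.Re B) => _ [n _ <-]; have := vB n; rewrite lecE => /andP[].
apply/cvg_ex; exists (limn (fun n => complex.Re (v n)) +i* complex.Im (v 0%N)).
apply/cvgrPdist_lt => e; rewrite ltcE => /andP[/eqP /= Ime Ree].
have /cvgrPdist_lt/(_ _ Ree) := a_cvg.
apply: filterS => n; set a := limn _ => an.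
have -> : a +i* complex.Im (v 0%N) - v n = (a - complex.Re (v n))%:C.
  have := v_ndecr 0%N n (leq0n n); rewrite lecE => /andP[/eqP <- _].
  apply/eqP; rewrite eq_complex /=; case: (v n) => x y /=.
  by rewrite subrr !eqxx.
by rewrite normc_real ltcE /= Ime eqxx.
Qed.

(** A form of completeness of the complex numbers.  If r is the real or the
    imaginary part of u, then r + v is nondecreasing and bounded, hence
    converges, and so does r = (r + v) - v. *)
Lemma dominated_cvgn (u v : nat -> C) (B : C) :
  (forall n m, (n <= m)%N -> `|u m - u n| <= v m - v n) ->
  (forall n, v n <= B) -> cvgn u.
Proof.
move=> uv vB.
have v_ndecr : {homo v : n m / (n <= m)%N >-> n <= m}.
  by move=> n m /uv /(le_trans (normr_ge0 _)); rewrite subr_ge0.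
have v_cvg := nondecreasing_bounded_cvgn v_ndecr vB.
have real_part (r : nat -> R) :
    (forall n m, (n <= m)%N -> `|(r m - r n)%:C| <= v m - v n) ->
    cvgn (fun n => (r n)%:C : C).
  move=> rv.
  have rv_real n m (nm : (n <= m)%N) :
      - (v m - v n) <= (r m)%:C - (r n)%:C <= v m - v n.
    rewrite -rmorphB -real_ler_norml ?rv//; apply/complex_realP.
    by exists (r m - r n).
  have s_cvg : cvgn (fun n => (r n)%:C + v n : C).
    apply: (@nondecreasing_bounded_cvgn _ ((r 0%N)%:C + (B - v 0%N) + B)).
      move=> n m /rv_real /andP[+ _].
      by rewrite lerNl opprB !lerBlDr addrAC -lerBlDr opprK [v m + _]addrC.
    move=> n; apply: lerD => //; have /rv_real/andP[_] := leq0n n.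
    by rewrite lerBlDl => /le_trans; apply; rewrite lerD2l lerD2r.
  have -> : (fun n => (r n)%:C : C) = (fun n => (r n)%:C + v n : C) - v.
    by apply/funext => n; rewrite !fctE addrK.
  exact: (is_cvgB s_cvg v_cvg).
have Re_cvg := real_part (fun n => complex.Re (u n)).
have Im_cvg := real_part (fun n => complex.Im (u n)).
have -> : u = (fun n => (complex.Re (u n))%:C : C) +
              (fun=> 'i : C) \* (fun n => (complex.Im (u n))%:C : C).
  by apply/funext => n; rewrite fctE; exact: complexE.
apply: (is_cvgD (Re_cvg _) (is_cvgM (is_cvg_cst _) (Im_cvg _))).
  by move=> n m /uv; apply: le_trans; rewrite -raddfB; exact: normc_Re.
by move=> n m /uv; apply: le_trans; rewrite -raddfB; exact: normc_Im.
Qed.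

End ComplexSequences.

Lemma cvgn_unique (R : realType) (u : nat -> (R[i])^o) (l l' : (R[i])^o) :
  u @ \oo --> l -> u @ \oo --> l' -> l = l'.
Proof. exact: cvg_unique. Qed.

Lemma cvgn_limE (R : realType) (u : nat -> (R[i])^o) (l : (R[i])^o) :
  u @ \oo --> l -> limn u = l.
Proof. exact: cvg_lim. Qed.

Lemma cvgn_cauchy (R : realType) (v : nat -> (R[i])^o) (e : R[i]) :
  cvgn v -> 0 < e ->
  exists N0, forall N M, (N0 <= N)%N -> (N0 <= M)%N -> `|v M - v N| < e.
Proof.
move=> /cvg_ex[l] /cvgrPdist_lt vl e0.
have [N0 _ vN0] := vl (e / 2) (divr_gt0 e0 (ltr0n _ 2)).
exists N0 => N M N0N N0M; rewrite [e]splitr -(subrKA l).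
apply: le_lt_trans (ler_normD _ _) _.
by rewrite ltrD//; [rewrite distrC|]; exact: vN0.
Qed.

Lemma cvgn_sum (R : realType) (I : Type) (r : seq I)
    (f : I -> nat -> (R[i])^o) (l : I -> (R[i])^o) :
  (forall i, f i @ \oo --> l i) ->
  (fun n => \sum_(i <- r) f i n) @ \oo --> \sum_(i <- r) l i.
Proof.
move=> fl; elim: r => [|i r IHr].
  rewrite big_nil; under [X in X @ _]funext do rewrite big_nil.
  exact: cvg_cst.
rewrite big_cons; under [X in X @ _]funext do rewrite big_cons.
exact: (cvgD (fl i) IHr).
Qed.

(** * Boards for which the products of the 1 + |w_i| are bounded *)

Lemma coef_board_poly_ge0 (K : numDomainType) (w : nat -> K) N m :
  (forall i, 0 <= w i) -> 0 <= (board_poly w N)`_m.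
Proof.
move=> w0; rewrite /board_poly coef_prod_linear sumr_ge0// => A _.
exact: prodr_ge0.
Qed.

Lemma sum_coef_board_poly_le (K : numDomainType) (w : nat -> K) N M :
  (forall i, 0 <= w i) ->
  \sum_(0 <= m < M) (board_poly w N)`_m <= \prod_(i < N) (1 + w i).
Proof.
move=> w0; rewrite -horner1_board_poly.
have size_le : (size (board_poly w N) <= maxn M N.+1)%N.
  by rewrite (leq_trans (size_board_poly _ _)) ?leq_maxr.
rewrite (horner1_sum_coef size_le) (big_cat_nat (leq0n M) (leq_maxl _ _)) /=.
by rewrite lerDl sumr_ge0// => m _; exact: coef_board_poly_ge0.
Qed.

Lemma dist_coef_board_poly (K : numFieldType) (Fw : position -> K) m N M :
  (N <= M)%N ->
  `|(board_poly (fun i => Fw (pos i)) M)`_m -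
    (board_poly (fun i => Fw (pos i)) N)`_m| <=
  (board_poly (fun i => `|Fw (pos i)|) M)`_m -
  (board_poly (fun i => `|Fw (pos i)|) N)`_m.
Proof.
move=> NM; rewrite -{1}sum_bounded_tilings.
by apply: dist_sum_tilings => //; exact: sub_bounded_tilings.
Qed.

Section SummableBoard.
Variables (R : realType) (Fw : position -> R[i]) (B : R[i]).
Let w i := Fw (pos i).
Let nw i := `|Fw (pos i)|.
Hypothesis prod_le : forall N, \prod_(i < N) (1 + nw i) <= B.
Local Notation C := (R[i])^o.

Let nw_ge0 i : 0 <= nw i. Proof. exact: normr_ge0. Qed.

Let coef_le N m : (board_poly nw N)`_m <= B.
Proof.
apply: le_trans (prod_le N).
apply: le_trans (sum_coef_board_poly_le N m.+1 nw_ge0).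
rewrite big_nat_recr//= lerDr sumr_ge0// => i _; exact: coef_board_poly_ge0.
Qed.

Lemma coef_board_poly_cvgn m : cvgn (fun N => (board_poly w N)`_m : C).
Proof.
apply: (@dominated_cvgn _ _ (fun N => (board_poly nw N)`_m) B).
  by move=> N M NM; exact: dist_coef_board_poly.
by move=> N; exact: coef_le.
Qed.

(** Once N is so large that the dominating coefficients vary little beyond N,
    every finite Y containing the tilings bounded by N has nearly the same
    sum. *)
Lemma sum_tilings_cvg m :
  (fun X : set coloring => \sum_(T \in X) tiling_weight Fw T : C) @
    finite_subsets (tilings m) --> limn (fun N => (board_poly w N)`_m : C).
Proof.
have nw_cvg : cvgn (fun N => (board_poly nw N)`_m : C).
  apply: (@dominated_cvgn _ _ (fun N => (board_poly nw N)`_m) B) => //.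
  move=> N M NM; rewrite ger0_norm// subr_ge0 -subr_ge0.
  exact: le_trans (normr_ge0 _) (dist_coef_board_poly Fw m NM).
apply/cvgrPdist_lt => e e0.
have e2 : 0 < e / 2 by rewrite divr_gt0.
have [N0 nw_small] := cvgn_cauchy nw_cvg e2.
have /cvgrPdist_lt/(_ _ e2)[N1 _ w_close] := coef_board_poly_cvgn (m := m).
pose N := maxn N0 N1.
exists (bounded_tilings N m).
  by split; [exact: finite_bounded_tilings | move=> T []].
move=> Y [AY NY] /=.
have [M NM YM] := bounded_tilings_cofinal N AY.
rewrite [e]splitr -(subrKA (board_poly w N)`_m).
apply: le_lt_trans (ler_normD _ _) _.
rewrite ltrD//; first by apply: w_close; exact: leq_maxr.
rewrite distrC; apply: le_lt_trans (dist_sum_tilings Fw NY YM) _.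
apply: le_lt_trans (nw_small N M _ _); last 2 first.
- exact: leq_maxl.
- exact: leq_trans (leq_maxl _ _) NM.
rewrite ger0_norm//.
exact: le_trans (normr_ge0 _) (dist_coef_board_poly Fw m NM).
Qed.

Lemma usummable_board m : usummable (tilings m) (tiling_weight Fw).
Proof. by apply/cvg_ex; eexists; exact: sum_tilings_cvg. Qed.

Lemma board_gf_cvg m :
  (fun N => (board_poly w N)`_m : C) @ \oo --> (board_gf Fw m%:Z : C).
Proof.
have -> : board_gf Fw m%:Z = limn (fun N => (board_poly w N)`_m : C).
  by apply: cvg_lim => //; exact: sum_tilings_cvg.
exact: coef_board_poly_cvgn.
Qed.

Let V N := (\prod_(i < N) (1 + nw i) : C).

(** For M > N the sum of the first M coefficients of B_N is B_N(1), while for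
    the absolute weights at N' they add up to at most V N'. *)
Let dist_sum_coef M N N' : (N < M)%N -> (N <= N')%N ->
  `|\sum_(0 <= m < M) (board_poly w N')`_m - \prod_(i < N) (1 + w i)| <=
  V N' - V N.
Proof.
move=> NM NN'; rewrite -horner1_board_poly /V -(horner1_board_poly nw N).
rewrite !(@horner1_sum_coef _ _ M);
  try exact: leq_trans (size_board_poly _ _) _.
rewrite -sumrB; apply: le_trans (ler_norm_sum _ _ _) _.
apply: (@le_trans _ _ (\sum_(0 <= m < M) (board_poly nw N')`_m -
                       \sum_(0 <= m < M) (board_poly nw N)`_m)).
  by rewrite -sumrB ler_sum// => m _; exact: dist_coef_board_poly.
by rewrite lerB// sum_coef_board_poly_le.
Qed.

Let dist_prod N N' : (N <= N')%N ->
  `|\prod_(i < N') (1 + w i) - \prod_(i < N) (1 + w i)| <= V N' - V N.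
Proof.
move=> NN'; have := dist_sum_coef (M := N'.+1) NN' NN'.
rewrite -horner1_sum_coef ?size_board_poly// horner1_board_poly; exact.
Qed.

Lemma board_prod_cvgn : cvgn (fun N => \prod_(i < N) (1 + w i) : C).
Proof. exact: (dominated_cvgn dist_prod prod_le). Qed.

(** Fix N with V nearly constant beyond N.  For each M > N, the estimate
    dist_sum_coef holds for all N' >= N with a bound uniform in M, so letting
    N' grow transfers it to the partial sum of the F(m). *)
Lemma sum_board_gf_cvg :
  (fun M => \sum_(0 <= m < M) board_gf Fw m%:Z : C) @ \oo -->
  limn (fun N => \prod_(i < N) (1 + w i) : C).
Proof.
have V_cvg : cvgn V.
  apply: (@dominated_cvgn _ _ V B) => // N M NM.
  by rewrite ger0_norm//; exact: le_trans (normr_ge0 _) (dist_prod NM).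
apply/cvgrPdist_lt => e e0.
have e2 : 0 < e / 2 by rewrite divr_gt0.
have e4 : 0 < e / 2 / 2 by rewrite divr_gt0.
have [N0 V_small] := cvgn_cauchy V_cvg e4.
have /cvgrPdist_lt/(_ _ e2)[N1 _ prod_close] := board_prod_cvgn.
pose N := maxn N0 N1.
exists N.+1 => // M /= NM.
have : (fun N' => \sum_(0 <= m < M) (board_poly w N')`_m : C) @ \oo -->
    (\sum_(0 <= m < M) board_gf Fw m%:Z : C).
  by apply: cvgn_sum => m; exact: board_gf_cvg.
move=> /cvgrPdist_lt/(_ _ e4)[N2 _ sum_close].
pose N' := maxn N N2.
(* The product at N is within e/2 of its limit and within e/4 of the sum of the
   first M coefficients at N', itself within e/4 of the partial sum. *)
rewrite [e]splitr -(subrKA (\prod_(i < N) (1 + w i))).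
apply: le_lt_trans (ler_normD _ _) _.
rewrite ltrD//; first by apply: prod_close; exact: leq_maxr.
rewrite [e / 2]splitr -(subrKA (\sum_(0 <= m < M) (board_poly w N')`_m)).
apply: le_lt_trans (ler_normD _ _) _.
rewrite ltrD// distrC; last by apply: sum_close; exact: leq_maxr.
apply: le_lt_trans (dist_sum_coef NM (leq_maxl _ _)) _.
apply: le_lt_trans (V_small N N' _ _); last 2 first.
- exact: leq_maxl.
- exact: leq_trans (leq_maxl _ _) (leq_maxl _ _).
rewrite ger0_norm//.
exact: le_trans (normr_ge0 _) (dist_prod (leq_maxl _ _)).
Qed.

End SummableBoard.

(** * The board with weights z_j q^(n+1) *)

Lemma prod_1D_le_expR (R : realType) N (a : nat -> R) : (forall i, 0 <= a i) ->
  \prod_(i < N) (1 + a i) <= expR (\sum_(i < N) a i).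
Proof.
move=> a0; elim: N => [|N IHN]; first by rewrite !big_ord0 expR0.
rewrite !big_ord_recr /= expRD ler_pM ?expR_ge1Dx//.
  by rewrite prodr_ge0// => i _; rewrite addr_ge0.
by rewrite addr_ge0.
Qed.

Section PeriodicBoard.
Variables (R : realType) (k : nat) (z : 'I_k -> R[i]) (q : R[i]).
Variable Fw : position -> R[i].
Hypothesis k_gt0 : (0 < k)%N.
Hypothesis q_lt1 : `|q| < 1.
Hypothesis FwE : forall (n : nat) (j : 'I_k) (i : position),
  val i = (k * n + j.+1)%N -> Fw i = z j * q ^+ n.+1.
Local Notation C := (R[i])^o.
Let w i := Fw (pos i).

Lemma weight_block n (j : 'I_k) : w (k * n + j) = z j * q ^+ n.+1.
Proof. by apply: FwE; rewrite addnS. Qed.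

(** Moving k positions to the right keeps z_j and raises the power of q by 1. *)
Lemma weight_shift i : w (k + i) = q * w i.
Proof.
have j_lt : (i %% k < k)%N by rewrite ltn_mod.
have wi n : w (k * n + i %% k) = z (Ordinal j_lt) * q ^+ n.+1 :=
  weight_block n (Ordinal j_lt).
rewrite (divn_eq i k) [(_ * k)%N]mulnC wi addnA -mulnS wi.
by rewrite [q ^+ _.+2]exprS mulrCA.
Qed.

(** If s_N is the sum of the first N absolute weights, then
    s_N <= s_(k+N) = s_k + |q| s_N, so s_N <= s_k / (1 - |q|); exponentiating
    bounds the products. *)
Lemma weight_prod_bounded :
  exists B : R[i], forall N, \prod_(i < N) (1 + `|w i|) <= B.
Proof.
have q1_gt0 : 0 < 1 - `|q| by rewrite subr_gt0.
pose b := (\sum_(i < k) `|w i|) / (1 - `|q|).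
have sum_le N : \sum_(i < N) `|w i| <= b.
  rewrite ler_pdivlMr// mulrBr mulr1 lerBlDr mulrC mulr_sumr.
  under [X in _ <= _ + X]eq_bigr do rewrite -normrM -weight_shift.
  have <- : \sum_(i < k + N) `|w i| =
      \sum_(i < k) `|w i| + \sum_(i < N) `|w (k + i)|.
    by rewrite big_split_ord.
  by rewrite addnC big_split_ord /= lerDl sumr_ge0.
pose a i := complex.Re `|w i|.
have aE i : (a i)%:C = `|w i| by rewrite RRe_real ?normr_real.
exists (expR (complex.Re b))%:C => N.
under eq_bigr do rewrite -aE -(rmorph1 (real_complex R)) -rmorphD.
rewrite -rmorph_prod lecR; apply: le_trans (prod_1D_le_expR _ _) _.
  by move=> i; rewrite -ler0c aE.
rewrite ler_expR; have := sum_le N; under eq_bigr do rewrite -aE.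
by rewrite -rmorph_sum lecE => /andP[].
Qed.

(** The coefficient form of B_(k+N)(t) = A(q t) B_N(q t). *)
Lemma coef_board_poly_shift N m :
  (board_poly w (k + N))`_m =
  q ^+ m * \sum_(r < m.+1) elem_sym r z * (board_poly w N)`_(m - r).
Proof.
rewrite board_polyD coefM mulr_sumr; apply: eq_bigr => r _.
have -> : (fun i => w (k + i)%N) = (fun i => q * w i).
  by apply/funext => i; exact: weight_shift.
have -> : (board_poly w k)`_r = q ^+ r * elem_sym r z.
  rewrite -coef_prod_elem_sym /board_poly !coef_prod_linear mulr_sumr.
  apply: eq_bigr => A /eqP <-; rewrite -prodr_const -big_split /=.
  apply: eq_bigr => j _; have := weight_block 0 j.
  by rewrite muln0 add0n expr1 mulrC.
rewrite coef_board_poly_scale mulrACA -exprD subnKC//.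
by rewrite -ltnS.
Qed.

(** Both sides are limits in N of the two sides of coef_board_poly_shift. *)
Lemma board_gf_functional m :
  board_gf Fw m%:Z =
  q ^+ m * \sum_(r < m.+1) elem_sym r z * board_gf Fw (m - r)%N%:Z.
Proof.
have [B wB] := weight_prod_bounded.
have cvgF := board_gf_cvg wB.
have lim_shift : (fun N => (board_poly w (k + N))`_m : C) @ \oo -->
    (board_gf Fw m%:Z : C).
  by apply: cvg_comp (cvgF m); exact: cvg_addnl.
apply: (cvgn_unique lim_shift).
under [X in X @ _]funext do rewrite coef_board_poly_shift.
apply: (@cvgM _ _ _ _ (fun=> q ^+ m : C)); first exact: cvg_cst.
apply: cvgn_sum => r.
apply: (@cvgM _ _ _ _ (fun=> elem_sym r z : C)); first exact: cvg_cst.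
exact: cvgF.
Qed.

Lemma board_gf0 : board_gf Fw 0 = 1.
Proof.
have [B wB] := weight_prod_bounded.
apply: (cvgn_unique (board_gf_cvg wB (m := 0))).
under [X in X @ _]funext do rewrite /board_poly coef0_prod_linear.
exact: cvg_cst.
Qed.

(** The term r = 0 of board_gf_functional is q^m F(m); it is moved to the left,
    where 1 - q^m is nonzero because |q| < 1. *)
Lemma board_gf_rec m : (0 < m)%N ->
  board_gf Fw m%:Z = q ^+ m / (1 - q ^+ m) *
    \sum_(r < m) elem_sym r.+1 z * board_gf Fw (m - r.+1)%N%:Z.
Proof.
move=> m_gt0.
have qm_neq1 : 1 - q ^+ m != 0.
  rewrite subr_eq0; apply: contraTneq q_lt1 => qm1.
  have : `|q| ^+ m = 1 by rewrite -normrX -qm1 normr1.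
  move=> /eqP; rewrite pexpr_eq1// => /eqP ->.
  by rewrite ltxx.
apply: (mulIf qm_neq1); rewrite mulrAC divfK//.
rewrite mulrBr mulr1 {1}board_gf_functional big_ord_recl elem_sym0 mul1r subn0.
by rewrite mulrDr [board_gf _ _ * _]mulrC addrAC subrr add0r.
Qed.

(** The ranges r <= m and r <= k give the same sum: beyond m the factor F(m - r)
    vanishes, and beyond k the factor S_r does. *)
Lemma board_gf_rec_trunc m : (0 < m)%N ->
  board_gf Fw m%:Z = q ^+ m / (1 - q ^+ m) *
    \sum_(1 <= n < k.+1) elem_sym n z * board_gf Fw (m%:Z - n%:Z).
Proof.
move=> m_gt0; rewrite board_gf_rec//; congr (_ * _).
pose G n := elem_sym n z * board_gf Fw (m%:Z - n%:Z).
have G_gtk n : (k < n)%N -> G n = 0 by move=> kn; rewrite /G elem_sym_gt ?mul0r.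
have G_gtm n : (m < n)%N -> G n = 0.
  move=> mn; rewrite /G; have -> : m%:Z - n%:Z = Negz (n - m.+1).
    by rewrite NegzE subnSK// -subzn 1?ltnW// opprB.
  by rewrite mulr0.
have trunc a : (forall n, (a < n)%N -> G n = 0) -> (a <= m + k)%N ->
    \sum_(1 <= n < a.+1) G n = \sum_(1 <= n < (m + k).+1) G n.
  move=> Ga amk; rewrite [RHS](big_cat_nat (n := a.+1))//=.
  rewrite [X in _ = _ + X]big_nat_cond [X in _ = _ + X]big1 ?addr0//.
  by move=> n /andP[/andP[/Ga]].
transitivity (\sum_(1 <= n < m.+1) G n).
  rewrite big_add1 /= big_mkord; apply: eq_bigr => r _.
  by rewrite /G subzn.
by rewrite !trunc ?leq_addr ?leq_addl.
Qed.

Lemma partial_prodE N :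
  \prod_(1 <= m < N.+1) \prod_(j < k) (1 + z j * q ^+ m) =
  \prod_(i < k * N) (1 + w i).
Proof.
elim: N => [|N IHN]; first by rewrite muln0 big_geq// big_ord0.
rewrite big_nat_recr//= IHN mulnSr big_split_ord /=; congr (_ * _).
by apply: eq_bigr => j _; rewrite weight_block.
Qed.

Lemma partial_prod_cvg :
  (fun N => \prod_(1 <= m < N.+1) \prod_(j < k) (1 + z j * q ^+ m) : C)
    @ \oo -->
  limn (fun N => \prod_(i < N) (1 + w i) : C).
Proof.
have [B wB] := weight_prod_bounded.
under [X in X @ _]funext do rewrite partial_prodE.
by apply: cvg_comp (board_prod_cvgn wB); exact: cvg_mulnl.
Qed.

End PeriodicBoard.

Theorem theorem6p5 (R : realType) (k : nat) (hk : (1 <= k)%N)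
    (z : 'I_k -> R[i]) (q : R[i]) (hq : `|q| < 1)
    (Fw : position -> R[i])
    (hFw : forall (n : nat) (j : 'I_k) (i : position),
        val i = (k * n + j.+1)%N -> Fw i = z j * q ^+ n.+1) :
  let F : int -> R[i] := board_gf Fw in
  let partial_prod : nat -> (R[i])^o :=
    fun N => \prod_(1 <= m < N.+1) \prod_(j < k) (1 + z j * q ^+ m) in
  let partial_sum : nat -> (R[i])^o :=
    fun N => \sum_(0 <= m < N) F m%:Z in
  [/\ forall m : nat, usummable (tilings m) (tiling_weight Fw),
      [/\ cvgn partial_prod, cvgn partial_sum &
          limn partial_prod = limn partial_sum],
      F 0 = 1,
      F 1 = q / (1 - q) * \sum_(i < k) z i /\
      q / (1 - q) * \sum_(i < k) z i = q / (1 - q) * elem_sym 1 z &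
      forall m : nat, (1 <= m)%N ->
        F m%:Z = q ^+ m / (1 - q ^+ m) *
          \sum_(1 <= n < k.+1) elem_sym n z * F (m%:Z - n%:Z)].
Proof.
move=> F partial_prod partial_sum.
have [B wB] := weight_prod_bounded hk hq hFw.
have prod_cvg := partial_prod_cvg hk hq hFw.
have sum_cvg := sum_board_gf_cvg wB.
have F0 : F 0 = 1 := board_gf0 hk hq hFw.
split.
- exact: (usummable_board wB).
- split; [exact: (cvgP _ prod_cvg) | exact: (cvgP _ sum_cvg) |].
  exact (eq_trans (cvgn_limE prod_cvg) (esym (cvgn_limE sum_cvg))).
- exact: F0.
- split; last by rewrite elem_sym1.
  have -> : F 1 = _ := board_gf_rec hk hq hFw (ltn0Sn 0).
  by rewrite big_ord1 subnn -/(F 0) F0 mulr1 expr1 elem_sym1.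
- exact: (board_gf_rec_trunc hk hq hFw).
Qed.
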